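(* Let $0<1/n\ll \varepsilon\ll \xi\ll \gamma\ll 1/r$ where $n,r\in\mathbb N$ and $r\ge 3$. Suppose that $G$ is a digraph on $n$ vertices such that for every $x\in V(G)$, $d^+(x)\ge (1-1/r-\varepsilon)n$ or $d^-(x)\ge(1-1/r-\varepsilon)n$. Further suppose that $G$ does not contain any $\gamma$-independent set of size at least $n/r$. Then $V(G)$ contains a set $M$ with $|M|\le \xi n$ such that $M$ is a $T_r$-absorbing set for every $W\subseteq V(G)\setminus M$ with $|W|\in r\mathbb N$ and $|W|\le \xi^2 n$.
   Context: Hierarchy notation: $0<a\ll b\ll c$ means the constants are chosen from right to left, each sufficiently small in terms of those to its right (there are increasing functions $f,g$ such that the statement holds whenever $b\le f(c)$ and $a\le g(b)$); longer hierarchies are analogous. A digraph has no loops and at most one edge in each direction between any two vertices; $d^\pm(x)$ are out-/indegree. $T_r$ is the transitive tournament on $r$ vertices. For a digraph $G$ on $n$ vertices, $S\subseteq V(G)$ is $\gamma$-independent if $G[S]$ has at most $\gamma n^2$ edges. A set $S\subseteq V(G)$ is a $T_r$-absorbing set for $Q\subseteq V(G)$ if both $G[S]$ and $G[S\cup Q]$ contain perfect $T_r$-packings (collections of vertex-disjoint, not necessarily induced, copies of $T_r$ covering all vertices). *)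

(* Defs.v *)
From mathcomp Require Import all_boot all_order all_algebra.
From mathcomp Require Import reals.

Set Implicit Arguments.
Unset Strict Implicit.
Unset Printing Implicit Defensive.

Import Order.TTheory GRing.Theory Num.Theory.
Local Open Scope ring_scope.

(* A digraph on the finite vertex set V is a relation e : rel V with
   [irreflexive e]; [e x y] says that the edge from x to y is present. *)

Definition outdeg (V : finType) (e : rel V) (x : V) : nat := #|[set y | e x y]|.

Definition indeg (V : finType) (e : rel V) (x : V) : nat := #|[set y | e y x]|.

(* The number of edges of G[S]; opposite edges x -> y and y -> x count twice. *)
Definition nb_edges_in (V : finType) (e : rel V) (S : {set V}) : nat :=
  #|[set p : V * V | [&& p.1 \in S, p.2 \in S & e p.1 p.2]]|.

Definition gamma_independent (R : realType) (V : finType) (e : rel V)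
    (gamma : R) (S : {set V}) : Prop :=
  (nb_edges_in e S)%:R <= gamma * #|V|%:R ^+ 2.

Definition transitive_tournament (r : nat) : rel 'I_r :=
  fun i j => (i < j)%N.

(* B is the vertex set of a (not necessarily induced) copy of h in e. *)
Definition spans_copy (U V : finType) (h : rel U) (e : rel V)
    (B : {set V}) : Prop :=
  exists f : U -> V,
    [/\ injective f, (forall u v, h u v -> e (f u) (f v)) & f @: [set: U] = B].

(* A perfect h-packing of G[S], recorded by the partition of S into the vertex
   sets of the copies. *)
Definition has_perfect_packing (U V : finType) (h : rel U) (e : rel V)
    (S : {set V}) : Prop :=
  exists P : {set {set V}},
    partition P S /\ (forall B, B \in P -> spans_copy h e B).

Definition absorbing (U V : finType) (h : rel U) (e : rel V)
    (S Q : {set V}) : Prop :=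
  has_perfect_packing h e S /\ has_perfect_packing h e (S :|: Q).

(* The functions witnessing a hierarchy: a << b is read as a <= f b for such
   an f. All the constants lie in (0, 1], so f only matters there. *)
Definition hierarchy_fun (R : realType) (f : R -> R) : Prop :=
  (forall x, 0 < x <= 1 -> 0 < f x <= 1) /\
  (forall x y, 0 < x -> x < y -> y <= 1 -> f x < f y).

(* Main.v *)
Require Import Defs.
From mathcomp Require Import all_boot all_order all_algebra.
From mathcomp Require Import boolp reals lra ring zify.

Set Implicit Arguments.
Unset Strict Implicit.
Unset Printing Implicit Defensive.

Import Order.TTheory GRing.Theory Num.Theory.
Local Open Scope ring_scope.

(** Write [N x] for the large in- or out-neighbourhood of [x]. Adding [x] to a
transitive tournament inside [N x] gives a transitive tournament, with [x] as
its source or its sink; so picking vertices successively inside the previous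
neighbourhoods builds transitive tournaments greedily. For any [x] and [y] the
set [N x :&: N y] misses about [2n/r] vertices, so after [r - 3] greedy steps
about [n/r] candidates are left; they span many edges, since there is no large
gamma-independent set. Hence a positive proportion of the [(r-1)]-tuples are
copies [X] of [T_(r-1)] such that both [x :: X] and [y :: X] span [T_r]. An
absorber of [q_1, ..., q_r] consists of a copy [y_1, ..., y_r] of [T_r] and of
such a set [X_i] for each pair [(y_i, q_i)]: it is tiled by the [y_i :: X_i],
and together with the [q_i] by the [q_i :: X_i] and the copy [y].

A linear family of disjoint absorbers is chosen deterministically: each [r]-tuple
[Q] has weight [2^-(number of chosen absorbers of Q)], and averaging yields a new
absorber which reduces the total weight by a constant factor. In the end the
total weight is so small that each [Q] has at least as many absorbers as [W] has
blocks of size [r]. *)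

(** * Greedy choice of sequences, and averaging over it *)

Section GreedyChoices.
Variables (R : realType) (V : finType) (c : R).

(* [many k P] says that a sequence satisfying [P] can be built by choosing [k]
   vertices one at a time, with at least [c * #|V|] options at each step. *)
Fixpoint many (k : nat) (P : seq V -> Prop) : Prop :=
  if k is k'.+1 then
    c * #|V|%:R <= #|[set v | `[< many k' (fun s => P (v :: s)) >]]|%:R
  else P [::].

Lemma many_mono k (P Q : seq V -> Prop) :
  (forall s, size s = k -> P s -> Q s) -> many k P -> many k Q.
Proof.
elim: k P Q => [|k IHk] P Q PQ /=; first exact: PQ.
move=> /le_trans; apply; rewrite ler_nat; apply: subset_leq_card.
apply/subsetP => v; rewrite !inE => /asboolP Pv; apply/asboolP.
by apply: IHk Pv => s sk; apply: PQ; rewrite /= sk.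
Qed.

Lemma manyS k (P : seq V -> Prop) (A : {set V}) :
    c * #|V|%:R <= #|A|%:R ->
    (forall v, v \in A -> many k (fun s => P (v :: s))) ->
  many k.+1 P.
Proof.
move=> cA PA /=; apply: le_trans cA _; rewrite ler_nat; apply: subset_leq_card.
by apply/subsetP => v vA; rewrite inE; apply/asboolP/PA.
Qed.

Lemma many_cat k1 k2 (P : seq V -> Prop) :
  many k1 (fun s1 => many k2 (fun s2 => P (s1 ++ s2))) -> many (k1 + k2) P.
Proof.
elim: k1 P => [//|k1 IHk] P /= /le_trans; apply.
rewrite ler_nat; apply: subset_leq_card.
by apply/subsetP => v; rewrite !inE => /asboolP Pv; apply/asboolP/IHk.
Qed.

(** One sequence serves many indices at once: at each step some vertex keeps at least a proportion
    [c] of the remaining weight, which gives the factor [c ^+ k] after [k] steps. *)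
Lemma many_weighted_choice (I : finType) (w : I -> R) (P : I -> seq V -> Prop) k :
    (0 < #|V|)%N -> 0 <= c -> (forall i, 0 <= w i) ->
  exists2 s, size s = k &
    c ^+ k * (\sum_(i | `[< many k (P i) >]) w i) <= \sum_(i | `[< P i s >]) w i.
Proof.
move=> V0 c0 w0; elim: k P => [|k IHk] P; first by exists [::]; rewrite // expr0 mul1r.
pose T v := \sum_(i | `[< many k (fun s => P i (v :: s)) >]) w i.
set S := \sum_(i | _) w i.
(* Double counting of the pairs [(i, v)]: each index counted in [S] is counted in [T v] for at least
   [c * #|V|] vertices [v]. *)
have sumT : S * (c * #|V|%:R) <= \sum_v T v.
  rewrite /T (exchange_big_dep xpredT) //= mulr_suml big_mkcond.
  apply: ler_sum => i _; rewrite sumr_const.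
  case: asboolP => [mi|_]; last by rewrite mulrn_wge0.
  rewrite -[leRHS]mulr_natr ler_wpM2l //; apply: le_trans mi _.
  by rewrite cardsE.
have [v vT] : exists v, c * S <= T v.
  apply/existsP; apply: contraT; rewrite negb_exists => /forallP ltT.
  suff : \sum_v T v < \sum_(v : V) c * S.
    by rewrite sumr_const -mulr_natr ltNge mulrAC mulrC sumT.
  apply: ltr_sum => [|v _]; last by rewrite ltNge.
  by have /card_gt0P[v _] := V0; apply/hasP; exists v; rewrite ?mem_index_enum.
have [s sk sP] := IHk (fun i s => P i (v :: s)).
exists (v :: s); rewrite /= ?sk //; apply: le_trans sP.
by rewrite exprSr -mulrA ler_wpM2l ?exprn_ge0.
Qed.

End GreedyChoices.

(** * Tilings by transitive tournaments *)

Section Tilings.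
Variables (V : finType) (e : rel V).

(** The transitive order is left open, so that a vertex can be put in front of the list whether it
    becomes the source or the sink. *)
Definition transitive_seq (s : seq V) : Prop :=
  exists2 t, perm_eq t s & pairwise e t.

(* Up to permutation, hence stable under concatenation with no disjointness
   condition, unlike [has_perfect_packing]. *)
Definition tiled (r : nat) (s : seq V) : Prop :=
  exists2 ss, perm_eq (flatten ss) s &
    forall t, t \in ss -> size t = r /\ pairwise e t.

Lemma tiled_perm r s1 s2 : perm_eq s1 s2 -> tiled r s1 -> tiled r s2.
Proof. by move=> s12 [ss /perm_trans ss1 ssP]; exists ss; rewrite ?ss1. Qed.

Lemma tiled_nil r : tiled r [::].
Proof. by exists [::]. Qed.

Lemma tiled_cat r s1 s2 : tiled r s1 -> tiled r s2 -> tiled r (s1 ++ s2).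
Proof.
move=> [ss1 p1 P1] [ss2 p2 P2]; exists (ss1 ++ ss2).
  by rewrite flatten_cat perm_cat.
by move=> t; rewrite mem_cat => /orP[/P1|/P2].
Qed.

Lemma tiled_transitive r s : size s = r -> transitive_seq s -> tiled r s.
Proof.
move=> sr [t ts et]; exists [:: t]; first by rewrite /= cats0.
by move=> u; rewrite inE => /eqP->; rewrite (perm_size ts).
Qed.

Lemma tiled_flatten r (ss : seq (seq V)) :
  (forall s, s \in ss -> tiled r s) -> tiled r (flatten ss).
Proof.
elim: ss => [_|s ss IHss ssP] /=; first exact: tiled_nil.
apply: tiled_cat; first by apply: ssP; rewrite mem_head.
by apply: IHss => t tss; apply: ssP; rewrite inE tss orbT.
Qed.

Lemma pairwise_spans_copy (t : seq V) : uniq t -> pairwise e t ->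
  spans_copy (@transitive_tournament (size t)) e [set x in t].
Proof.
case: t => [|x0 t']; last set t := x0 :: t'.
  (* The empty list offers no default vertex for [nth], so the empty map is used instead. *)
  move=> _ _; have f0 : 'I_0 -> V by case.
  exists f0; split; [by case | by case |].
  by apply/setP => x; rewrite !inE; apply/imsetP; case; case.
move=> ut /(pairwiseP x0) et; exists (fun i : 'I_(size t) => nth x0 t i); split.
- by move=> i j /eqP; rewrite nth_uniq // => /eqP/ord_inj.
- by move=> i j ij; apply: et => //; rewrite inE.
- apply/setP => x; rewrite inE; apply/imsetP/idP => [[i _ ->]|xt].
    by rewrite mem_nth.
  have xi : (index x t < size t)%N by rewrite index_mem.
  by exists (Ordinal xi); rewrite //= nth_index.
Qed.

Lemma perfect_packing0 (U : finType) (h : rel U) : has_perfect_packing h e set0.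
Proof.
by exists set0; split=> [|B]; rewrite ?inE // partition_set0.
Qed.

Lemma perfect_packingU1 (U : finType) (h : rel U) (B S : {set V}) :
    B != set0 -> [disjoint B & S] -> spans_copy h e B ->
  has_perfect_packing h e S -> has_perfect_packing h e (B :|: S).
Proof.
move=> B0 BS hB [P [PS hP]]; exists (B |: P); split; last first.
  by move=> C /setU1P[->|/hP].
have [/eqP cP tP nP] := and3P PS; apply/and3P; split.
- by apply/eqP; rewrite /cover bigcup_setU big_set1 -/(cover P) cP.
- have [] // := trivIsetU1 _ tP nP (A := B).
  by move=> C CP; apply: disjointWr BS; rewrite -cP; apply: (bigcup_max C).
- by rewrite !inE eq_sym negb_or B0.
Qed.

(** Uniqueness of [s] makes the blocks disjoint, and [0 < r] makes them nonempty, as [partition]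
    demands. *)
Lemma tiled_perfect_packing r (s : seq V) :
    (0 < r)%N -> uniq s -> tiled r s ->
  has_perfect_packing (@transitive_tournament r) e [set x in s].
Proof.
move=> r0 us [ss pss ssP].
rewrite -(eq_finset _ (perm_mem pss)); move: us; rewrite -(perm_uniq pss).
elim: ss ssP {pss} => [_ _|t ss IHss ssP] /=.
  by rewrite set_nil; apply: perfect_packing0.
rewrite cat_uniq => /and3P[ut tss uss].
have [tr et] := ssP t (mem_head _ _).
have -> : [set x in t ++ flatten ss] = [set x in t] :|: [set x in flatten ss].
  by apply/setP => x; rewrite !inE mem_cat.
apply: perfect_packingU1.
- apply/set0Pn; case: t tr {ssP tss ut et} => [r0'|x t' _]; first by rewrite -r0' in r0.
  by exists x; rewrite !inE eqxx.
- rewrite disjoint_sym disjoint_subset; apply/subsetP => x; rewrite !inE => xss.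
  by apply: contra tss => xt; apply/hasP; exists x.
- by rewrite -tr; apply: pairwise_spans_copy.
- by apply: IHss uss => u uss'; apply: ssP; rewrite inE uss' orbT.
Qed.

Definition absorbs (r : nat) (Q A : seq V) : Prop :=
  tiled r A /\ tiled r (A ++ Q).

(** The first [r] vertices of [W] are given to one of their absorbers in [F]. Removing it lowers
    every count by at most one, so [j - 1] absorbers remain for each block of the rest. *)
Lemma tiled_absorb r j (W : seq V) (F : seq (seq V)) :
    size W = (j * r)%N -> (forall A, A \in F -> tiled r A) ->
    (forall Q, size Q = r -> (j <= count (fun A => `[< absorbs r Q A >]) F)%N) ->
  tiled r (flatten F ++ W).
Proof.
elim: j W F => [|j IHj] W F.
  by move=> /size0nil-> FP _; rewrite cats0; apply: tiled_flatten.
move=> sW FP FQ; have rW : (r <= size W)%N by rewrite sW mulSn leq_addr.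
have stW : size (take r W) = r by apply: size_takel.
have [A AF /asboolP[_ AQ]] : exists2 A, A \in F & `[< absorbs r (take r W) A >].
  by apply/hasP; rewrite has_count; apply: leq_trans (FQ _ stW).
have pF := perm_to_rem AF.
apply: tiled_perm (_ : tiled r ((A ++ take r W) ++ (flatten (rem A F) ++ drop r W))).
  apply/permP => p; rewrite -{3}(cat_take_drop r W) !count_cat.
  have /permP -> := perm_flatten pF; rewrite /= count_cat; lia.
apply: tiled_cat AQ _; apply: IHj.
- by rewrite size_drop sW mulSn addKn.
- by move=> B /mem_rem/FP.
- by move=> Q sQ; rewrite count_rem; have := FQ Q sQ; case: (_ && _) => /=; lia.
Qed.

End Tilings.

(** * Cardinalities and edge counts *)

Lemma superset_of_card (T : finType) (A : {set T}) m :
  (#|A| <= m <= #|T|)%N -> exists2 S : {set T}, A \subset S & #|S| = m.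
Proof.
move=> /andP[Am mT]; have Dm : (m - #|A| <= size (enum (~: A)))%N.
  by rewrite -cardE; have := cardsC A; lia.
pose B := [set x in take (m - #|A|) (enum (~: A))].
have BA : [disjoint A & B].
  rewrite disjoint_sym disjoint_subset; apply/subsetP => x.
  by rewrite inE => /mem_take; rewrite mem_enum !inE.
exists (A :|: B); first exact: subsetUl.
move: BA; rewrite -(leq_card_setU A B) => /eqP->.
have /card_uniqP cB : uniq (take (m - #|A|) (enum (~: A))).
  by rewrite take_uniq ?enum_uniq.
by rewrite cardsE cB size_takel // subnKC.
Qed.

(** An edge of [S] that is not inside [A] has its tail or its head in [S :\: A]; each of the two
    cases accounts for at most [#|V| * #|S :\: A|] edges. *)
Lemma nb_edges_in_le (V : finType) (e : rel V) (A S : {set V}) :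
  (nb_edges_in e S <=
     \sum_(u in A) #|[set v in A | e u v]| + 2 * #|V| * #|S :\: A|)%N.
Proof.
have -> : (\sum_(u in A) #|[set v in A | e u v]| =
    #|[set p : V * V | [&& p.1 \in A, p.2 \in A & e p.1 p.2]]|)%N.
  under eq_bigr do rewrite -sum1_card; rewrite pair_big_dep -sum1_card.
  by apply: eq_bigl => p; rewrite !inE.
set E := [set p | _]; pose B := setX (S :\: A) [set: V].
pose C := setX [set: V] (S :\: A).
apply: leq_trans (_ : #|E :|: (B :|: C)| <= _)%N.
  apply: subset_leq_card; apply/subsetP => -[u v]; rewrite !inE /=.
  by case: (u \in A); case: (v \in A); case: (u \in S); case: (v \in S); case: (e u v).
apply: leq_trans (leq_card_setU _ _) _; rewrite leq_add2l.
apply: leq_trans (leq_card_setU _ _) _; rewrite !cardsX cardsT; lia.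
Qed.

Lemma card_setU_seq (T : finType) (F : {set T}) (s : seq T) :
  (#|F :|: [set x in s]| <= #|F| + size s)%N.
Proof.
by rewrite (leq_trans (leq_card_setU _ _)) // leq_add2l cardsE card_size.
Qed.

(** * Greedy construction of absorbers *)

Section Absorbers.
Variables (R : realType) (V : finType) (e : rel V) (r : nat) (eps gamma : R).
Variable N : V -> {set V}.
Local Notation n := (#|V|%:R : R).

Hypothesis irr : irreflexive e.
Hypothesis NE : forall x, N x = [set y | e x y] \/ N x = [set y | e y x].
Hypothesis cardN : forall x, (1 - r%:R^-1 - eps) * n <= #|N x|%:R.
Hypothesis dense : forall S : {set V},
  n / r%:R <= #|S|%:R -> gamma * n ^+ 2 < (nb_edges_in e S)%:R.
Hypothesis r3 : (3 <= r)%N.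
Hypothesis eps0 : 0 < eps.
Hypothesis gamma0 : 0 < gamma.
Hypothesis gamma_r : gamma <= r%:R^-1.
Hypothesis eps_gamma : r%:R * eps <= gamma / 16.
Hypothesis n_gamma : 8 <= gamma * n.

Local Notation many := (many (V := V) (gamma / 4)).

Lemma transitive_seq_cons v s :
  transitive_seq e s -> {subset s <= N v} -> transitive_seq e (v :: s).
Proof.
move=> [t ts et] sN; have tN x : x \in t -> x \in N v.
  by rewrite (perm_mem ts) => /sN.
case: (NE v) tN => -> tN.
  exists (v :: t); first by rewrite perm_cons.
  by rewrite /= et andbT; apply/allP => x /tN; rewrite inE.
exists (rcons t v); first by rewrite perm_rcons perm_cons.
by rewrite pairwise_rcons et andbT; apply/allP => x /tN; rewrite inE.
Qed.

(** Otherwise fewer than [gamma / 4 * n] vertices of [A] have outdegree at least [gamma / 4 * n] in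
    [A], so [A] spans at most [gamma / 2 * n ^+ 2] edges. Enlarging [A] to a set of size at least
    [n / r] adds at most [2 * n * (gamma / 8 * n + 1)] edges, which is at most [gamma / 2 * n ^+ 2]
    because [8 <= gamma * n]. This contradicts [dense]. *)
Lemma many_edges (A : {set V}) : (r%:R^-1 - gamma / 8) * n <= #|A|%:R ->
  many 2 (fun s => transitive_seq e s /\ {subset s <= A}).
Proof.
move=> cA; pose deg u := #|[set v in A | e u v]|.
pose B := [set u in A | gamma / 4 * n <= (deg u)%:R].
apply: (@manyS _ _ _ _ _ B); last first.
  move=> u; rewrite inE => /andP[uA]; move=> /manyS; apply=> v.
  rewrite inE => /andP[vA uv]; split; first by exists [:: u; v]; rewrite //= uv.
  by move=> x; rewrite !inE => /orP[]/eqP->.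
rewrite leNgt; apply/negP => cB.
have [e0 g0 gr eg ng] := And5 eps0 gamma0 gamma_r eps_gamma n_gamma.
have n0 : 0 < n by rewrite -(pmulr_rgt0 _ gamma0); lra.
have r0 : (0 : R) < r%:R by rewrite ltr0n (leq_trans _ r3).
have [S AS cS] : exists2 S : {set V},
    n / r%:R <= #|S|%:R & #|S :\: A|%:R <= gamma / 8 * n + 1.
  have [le_nA|lt_An] := lerP (n / r%:R) #|A|%:R.
    by exists A => //; rewrite setDv cards0; lra.
  have nr0 : 0 <= n / r%:R by rewrite divr_ge0 // ltW.
  have /andP[tn nt] := truncn_itv nr0.
  have nrn : n / r%:R < n.
    by rewrite ltr_pdivrMr // ltr_pMr // ltr1n (leq_trans _ r3).
  (* Rounding up costs the extra vertex in the bound on [S :\: A]; the size stays at most [#|V|]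
     because [n / r < n]. *)
  have [S AS cS] : exists2 S : {set V}, A \subset S & #|S| = (Num.trunc (n / r%:R)).+1.
    apply: superset_of_card; apply/andP; split.
      by rewrite -(ler_nat R); apply: le_trans (ltW nt); apply: ltW.
    by rewrite -(ltr_nat R) (le_lt_trans tn).
  exists S; first by rewrite cS ltW.
  rewrite cardsDS // natrB ?subset_leq_card // cS -addn1 natrD; lra.
have := dense AS; rewrite ltNge => /negP; apply.
have := nb_edges_in_le e A S; rewrite -(ler_nat R) natrD => /le_trans; apply.
rewrite !natrM natr_sum.
have : \sum_(u in A) (deg u)%:R <= #|B|%:R * n + n * (gamma / 4 * n).
  rewrite (bigID (mem B)) /=; apply: lerD.
    rewrite -natr_sum -natrM ler_nat -sum_nat_const.
    apply: leq_trans (_ : \sum_(u in A | u \in B) #|V| <= _)%N.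
      by apply: leq_sum => u _; apply: max_card.
    rewrite (eq_bigl (mem B)) // => u; rewrite !inE.
    by case: (u \in A).
  apply: le_trans (_ : \sum_(u : V) gamma / 4 * n <= _); last first.
    by rewrite sumr_const -[leLHS]mulr_natl.
  rewrite [leLHS]big_mkcond; apply: ler_sum => u _.
  case: ifP => [|_]; last by nra.
  by rewrite inE => /andP[->]; rewrite /= -ltNge => /ltW.
rewrite /deg; nra.
Qed.

(** Passing from [A] to [A :&: N v] loses at most [(r^-1 + eps) * n] vertices. After [k] such steps
    the set is still large enough for [many_edges], which supplies the last two vertices. *)
Lemma many_transitive k (A : {set V}) :
    (r%:R^-1 + k%:R * (r%:R^-1 + eps) - gamma / 8) * n <= #|A|%:R ->
  many k.+2 (fun s => transitive_seq e s /\ {subset s <= A}).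
Proof.
have r0 : (0 : R) < r%:R^-1 by rewrite invr_gt0 ltr0n (leq_trans _ r3).
have [e0 g0 gr eg ng] := And5 eps0 gamma0 gamma_r eps_gamma n_gamma.
have n0 : 0 < n by rewrite -(pmulr_rgt0 _ gamma0); lra.
elim: k A => [|k IHk] A cA; first by apply: many_edges; rewrite mul0r addr0 in cA.
apply: (@manyS _ _ _ _ _ A) => [|v vA].
  apply: le_trans cA; rewrite ler_pM2r //.
  have : 0 <= k.+1%:R * (r%:R^-1 + eps) by rewrite mulr_ge0 //; lra.
  lra.
have /IHk : (r%:R^-1 + k%:R * (r%:R^-1 + eps) - gamma / 8) * n <= #|A :&: N v|%:R.
  have := cardN v; have := cardsUI A (N v); have := max_card (mem (A :|: N v)).
  move: cA; rewrite -addn1 natrD -(ler_nat R) => cA cU /(congr1 (fun i => i%:R : R)).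
  rewrite !natrD; nra.
apply: many_mono => s _ [ts sA]; split.
  by apply: transitive_seq_cons => // x /sA; rewrite inE => /andP[].
by move=> x; rewrite inE => /predU1P[->//|/sA]; rewrite inE => /andP[].
Qed.

Lemma transitive_seq_uniq s : transitive_seq e s -> uniq s.
Proof.
move=> [t ts et]; rewrite -(perm_uniq ts) uniq_pairwise.
by apply: sub_pairwise et => x y /=; apply: contraTneq => ->; rewrite irr.
Qed.

(** For each pair [(x, y)] a copy of [T_(r-1)] is chosen in [N x :&: N y], so that either vertex
    completes it to a [T_r]. The set [F] grows by the vertices already chosen, which keeps the
    copies disjoint. *)
Lemma many_swaps (zs : seq (V * V)) (F : {set V}) :
    (#|F| + size zs * r)%:R <= gamma / 16 * n ->
  many (size zs * r.-1) (fun X => [/\ uniq X, {in X, forall x, x \notin F},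
    tiled e r (X ++ unzip1 zs) & tiled e r (X ++ unzip2 zs)]).
Proof.
elim: zs F => [|[x y] zs IHzs] F cF; first by split => //; apply: tiled_nil.
rewrite mulSn; apply: many_cat.
have r0 : (0 : R) < r%:R by rewrite ltr0n (leq_trans _ r3).
have [e0 g0 gr eg ng] := And5 eps0 gamma0 gamma_r eps_gamma n_gamma.
have n0 : 0 < n by rewrite -(pmulr_rgt0 _ gamma0); lra.
pose A := (N x :&: N y) :\: F.
(* The slack [gamma / 8] is split in two halves: one pays for [F], the other for the [r - 1] terms
   [eps], of which two come from [N x] and [N y]. *)
have cA : (r%:R^-1 + (r - 3)%:R * (r%:R^-1 + eps) - gamma / 8) * n <= #|A|%:R.
  have := cardN x; have := cardN y; have := cardsUI (N x) (N y).
  have := max_card (mem (N x :|: N y)).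
  have : (#|N x :&: N y| <= #|F| + #|A|)%N.
    by rewrite -(cardsID F) leq_add2r subset_leq_card ?subsetIr.
  have cF' : #|F|%:R <= gamma / 16 * n.
    by apply: le_trans cF; rewrite ler_nat leq_addr.
  rewrite -!(ler_nat R) natrD => cI cU /(congr1 (fun i => i%:R : R)).
  rewrite !natrD => cUI cy cx.
  have rV : r%:R * r%:R^-1 = 1 :> R by rewrite divff // gt_eqF.
  have : (r - 3)%:R * (r%:R^-1 + eps) <= 1 - 3 * r%:R^-1 + gamma / 16 - 3 * eps.
    by rewrite natrB // ; lra.
  have en : 0 < eps * n by rewrite mulr_gt0.
  rewrite -(ler_pM2r n0); lra.
have r3E : (r - 3).+2 = r.-1 by move: r3; clear; lia.
have := many_transitive cA; rewrite r3E.
apply: many_mono => X sX [tX XA].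
have XF : [disjoint [set z in X] & F].
  by rewrite disjoint_subset; apply/subsetP => z; rewrite inE => /XA; rewrite !inE => /andP[].
have /IHzs : (#|F :|: [set z in X]| + size zs * r)%:R <= gamma / 16 * n.
  apply: le_trans cF; rewrite ler_nat /= mulSn addnA leq_add2r.
  by rewrite (leq_trans (card_setU_seq _ _)) // leq_add2l sX leq_pred.
apply: many_mono => Y _ [uY YF t1 t2].
have NX z : {subset X <= N z} -> tiled e r (z :: X).
  move=> XN; apply: tiled_transitive; first by rewrite /= sX prednK // (leq_trans _ r3).
  exact: transitive_seq_cons.
split.
- rewrite cat_uniq uY (transitive_seq_uniq tX) andbT /=.
  by apply/hasPn => z /YF; rewrite !inE negb_or => /andP[].
- move=> z; rewrite mem_cat => /orP[/XA|/YF]; rewrite !inE.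
    by case/andP.
  by rewrite negb_or => /andP[].
- apply: tiled_perm (tiled_cat (NX x _) t1); last first.
    by move=> z /XA; rewrite !inE => /and3P[].
  by apply/permP => p; rewrite /= !count_cat /= -!addnA 2!(addnCA (p x : nat)).
- apply: tiled_perm (tiled_cat (NX y _) t2); last first.
    by move=> z /XA; rewrite !inE => /and3P[].
  by apply/permP => p; rewrite /= !count_cat /= -!addnA 2!(addnCA (p y : nat)).
Qed.

(** An absorber may meet [Q], and [Q] may have repeated entries: [tiled] counts multiplicities and
    asks for no disjointness. *)
Lemma many_absorbers (Q : seq V) (F : {set V}) :
    size Q = r -> (#|F| + r + r * r)%:R <= gamma / 16 * n ->
  many (r * r) (fun A =>
    [/\ uniq A, {in A, forall x, x \notin F} & absorbs e r Q A]).
Proof.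
(* First the copy [Y] of [T_r], then [r - 1] vertices for each of the [r] pairs in [zip Y Q]. *)
move=> sQ cF; rewrite (_ : r * r = r + r * r.-1)%N; last by nia.
apply: many_cat.
have r0 : (0 : R) < r%:R by rewrite ltr0n (leq_trans _ r3).
have [e0 g0 gr eg ng] := And5 eps0 gamma0 gamma_r eps_gamma n_gamma.
have n0 : 0 < n by rewrite -(pmulr_rgt0 _ gamma0); lra.
have cA : (r%:R^-1 + (r - 2)%:R * (r%:R^-1 + eps) - gamma / 8) * n <= #|~: F|%:R.
  have := cardsC F => /(congr1 (fun i => i%:R : R)); rewrite natrD => cFC.
  have cF' : #|F|%:R <= gamma / 16 * n.
    by apply: le_trans cF; rewrite ler_nat -addnA leq_addr.
  have rV : r%:R * r%:R^-1 = 1 :> R by rewrite divff // gt_eqF.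
  have : (r - 2)%:R * (r%:R^-1 + eps) <= 1 - 2 * r%:R^-1 + gamma / 16.
    by rewrite (natrB _ (ltnW r3)); lra.
  have rV0 : 0 < r%:R^-1 :> R by rewrite invr_gt0.
  rewrite -(ler_pM2r n0); nra.
have r2E : (r - 2).+2 = r by move: r3; clear; lia.
have := many_transitive cA; rewrite r2E.
apply: many_mono => Y sY [tY YF].
have szs : size (zip Y Q) = r by rewrite size_zip sY sQ minnn.
have /many_swaps : (#|F :|: [set z in Y]| + size (zip Y Q) * r)%:R <= gamma / 16 * n.
  apply: le_trans cF; rewrite ler_nat szs leq_add2r.
  by rewrite (leq_trans (card_setU_seq _ _)) // sY.
rewrite szs; apply: many_mono => X _ [uX XF].
rewrite unzip1_zip ?sY ?sQ // unzip2_zip ?sY ?sQ // => t1 t2; split.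
- rewrite cat_uniq uX (transitive_seq_uniq tY) andbT /=.
  by apply/hasPn => z /XF; rewrite !inE negb_or => /andP[].
- move=> z; rewrite mem_cat => /orP[/YF|/XF]; rewrite !inE //.
  by rewrite negb_or => /andP[].
- split; first by apply: tiled_perm t1; rewrite perm_catC.
  by rewrite -catA; apply: tiled_cat t2; apply: tiled_transitive.
Qed.

End Absorbers.

(** * Selection of a disjoint absorbing family by weights *)

Section AbsorbingFamily.
Variables (R : realType) (V : finType) (e : rel V) (r L B : nat) (c : R).

Hypothesis V0 : (0 < #|V|)%N.
Hypothesis c01 : 0 < c <= 1.
Hypothesis many_abs : forall (Q : seq V) (F : {set V}),
    size Q = r -> (#|F| <= B)%N ->
  many c L (fun A => [/\ uniq A, {in A, forall x, x \notin F} & absorbs e r Q A]).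

Local Notation nb_absorbers Q Fam :=
  (count (fun A => `[< absorbs e r Q A >]) Fam).

Lemma absorbing_family m : (m * L <= B)%N ->
  exists Fam : seq (seq V),
    [/\ uniq (flatten Fam), size (flatten Fam) = (m * L)%N,
        forall A, A \in Fam -> tiled e r A &
        \sum_(Q : r.-tuple V) 2^-1 ^+ nb_absorbers Q Fam
          <= (1 - c ^+ L / 2) ^+ m * #|V|%:R ^+ r].
Proof.
have /andP[c0 c1] := c01.
have cL1 : c ^+ L <= 1 by rewrite exprn_ile1 // ltW.
elim: m => [_|m IHm mB].
  exists [::]; split => //=.
  by under eq_bigr do rewrite expr0; rewrite sumr_const card_tuple natrX mul1r.
have [|Fam [uF sF tF wF]] := IHm; first by apply: leq_trans mB; rewrite leq_mul2r leqnSn orbT.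
pose w (Q : r.-tuple V) : R := 2^-1 ^+ nb_absorbers Q Fam.
have w0 Q : 0 < w Q by rewrite exprn_gt0 // invr_gt0.
pose P (Q : r.-tuple V) A :=
  [/\ uniq A, {in A, forall x, x \notin [set x in flatten Fam]} & absorbs e r Q A].
have [A sA] := many_weighted_choice P L V0 (ltW c0) (fun Q => ltW (w0 Q)).
(* The vertices used so far number at most [B], so every tuple still has many absorbers avoiding
   them, and the sum runs over all tuples. *)
rewrite (eq_bigl xpredT) => [|Q]; last first.
  apply/asboolP/many_abs; first by rewrite size_tuple.
  apply: leq_trans (_ : m * L <= _)%N; first by rewrite cardsE -sF card_size.
  by apply: leq_trans mB; rewrite leq_mul2r leqnSn orbT.
rewrite -/w => wA.
have wT : 0 < \sum_Q w Q.
  have /card_gt0P[v _] := V0.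
  rewrite (bigD1 [tuple of nseq r v]) //= ltr_pwDl ?w0 //.
  by apply: sumr_ge0 => Q _; apply: ltW.
(* The weight captured by [A] is positive, so [A] is an absorber of at least one tuple; hence it is
   tiled, has no repetition and avoids the earlier absorbers. *)
have [Q [uA AF [tA _]]] : exists Q, P Q A.
  apply: contrapT => /forallNP nP; move: wA; rewrite leNgt => /negP; apply.
  rewrite [ltLHS]big_pred0 => [|Q]; last first.
    by rewrite asboolF //; apply: nP.
  by rewrite mulr_gt0 // exprn_gt0.
exists (A :: Fam); split.
- rewrite /= cat_uniq uA uF andbT; apply/hasPn => x xF.
  by apply/negP => /AF; rewrite inE xF.
- by rewrite /= size_cat sA sF mulSn.
- by move=> C; rewrite inE => /predU1P[->|/tF].
rewrite exprS -mulrA; apply: le_trans (_ : (1 - c ^+ L / 2) * \sum_Q w Q <= _); last first.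
  by rewrite ler_wpM2l //; lra.
have half : \sum_(Q : r.-tuple V | `[< P Q A >]) w Q / 2 <= \sum_(Q : r.-tuple V | `[< absorbs e r Q A >]) w Q / 2.
  rewrite [leLHS]big_mkcond [leRHS]big_mkcond; apply: ler_sum => C _.
  case: asboolP => [[_ _ aC]|_]; first by rewrite asboolT.
  by case: ifP => // _; rewrite divr_ge0 // ltW.
rewrite -!mulr_suml in half.
have -> : \sum_(Q0 : r.-tuple V) 2^-1 ^+ nb_absorbers Q0 (A :: Fam) =
    \sum_Q w Q - \sum_(Q : r.-tuple V | `[< absorbs e r Q A >]) w Q / 2.
  rewrite [in X in _ - X]big_mkcond -sumrB; apply: eq_bigr => C _ /=.
  rewrite /w; case: asboolP => _ /=; last by rewrite subr0.
  by rewrite exprS; lra.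
rewrite -mulr_suml; lra.
Qed.

(** The total weight is at most [2^-j], hence so is the weight of each single tuple. *)
Lemma absorbing_family_count m j :
    (m * L <= B)%N ->
    #|V|%:R ^+ r * (1 - c ^+ L / 2) ^+ m * 2 ^+ j <= 1 ->
  exists Fam : seq (seq V),
    [/\ uniq (flatten Fam), size (flatten Fam) = (m * L)%N,
        forall A, A \in Fam -> tiled e r A &
        forall Q, size Q = r -> (j <= nb_absorbers Q Fam)%N].
Proof.
move=> /absorbing_family[Fam [uF sF tF wF]] Hj; exists Fam; split => // Q sQ.
have Qr : size Q == r by apply/eqP.
have : 2^-1 ^+ nb_absorbers Q Fam <= 2^-1 ^+ j :> R.
  apply: le_trans (_ : (1 - c ^+ L / 2) ^+ m * #|V|%:R ^+ r <= _); last first.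
    by rewrite exprVn -[leRHS]mul1r ler_pdivlMr ?exprn_gt0 // (mulrC (_ ^+ m)).
  apply: le_trans wF; rewrite (bigD1 (Tuple Qr)) //= lerDl.
  by apply: sumr_ge0 => C _; rewrite exprn_ge0 // invr_ge0.
by rewrite ler_iXn2l // ?invr_gt0 // invf_lt1 // ltr1n.
Qed.

Lemma absorbing_set m j :
    (0 < r)%N -> (m * L <= B)%N ->
    #|V|%:R ^+ r * (1 - c ^+ L / 2) ^+ m * 2 ^+ j <= 1 ->
  exists M : {set V}, (#|M| <= m * L)%N /\
    forall W : {set V},
      W \subset ~: M -> (r %| #|W|)%N -> (#|W| <= j)%N ->
      absorbing (@transitive_tournament r) e M W.
Proof.
move=> r0 mB /(absorbing_family_count mB)[Fam [uF sF tF jF]].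
exists [set x in flatten Fam]; split; first by rewrite cardsE -sF card_size.
move=> W WM /dvdnP[k Wk] Wj; split.
  by apply: tiled_perfect_packing => //; apply: tiled_flatten.
have -> : [set x in flatten Fam] :|: W = [set x in flatten Fam ++ enum W].
  by apply/setP => x; rewrite !inE mem_cat mem_enum.
apply: tiled_perfect_packing => //.
  rewrite cat_uniq uF enum_uniq andbT; apply/hasPn => x; rewrite mem_enum.
  by move=> /(subsetP WM); rewrite !inE.
apply: (tiled_absorb (j := k)) => //; first by rewrite -cardE.
(* The number [k] of blocks is bounded crudely by [#|W|]. *)
move=> Q /jF; apply: leq_trans; apply: leq_trans Wj.
by rewrite Wk leq_pmulr.
Qed.

End AbsorbingFamily.

(** * Numerical estimates *)

Lemma bernoulli_ineq (R : realDomainType) (a : R) n :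
  0 <= a -> 1 + n%:R * a <= (1 + a) ^+ n.
Proof.
move=> a0; elim: n => [|n IHn]; first by rewrite mul0r addr0.
have n0 : 0 <= n%:R * a * a by rewrite !mulr_ge0.
by rewrite exprS -addn1 natrD; nra.
Qed.

(** Since [(1 - a) * (1 + a) <= 1] and [(1 + a) ^+ q >= 2] by Bernoulli, every [q] factors halve the
    product, and [j + r * l] halvings offset [2 ^+ j * N ^+ r]. *)
Lemma exp_decay (R : realFieldType) (a : R) (N r m j q l : nat) :
    0 <= a <= 1 -> 1 <= q%:R * a -> (N <= 2 ^ l)%N -> (q * (j + r * l) <= m)%N ->
  N%:R ^+ r * (1 - a) ^+ m * 2 ^+ j <= 1.
Proof.
move=> /andP[a0 a1] qa Nl qm.
have a1' : 0 <= 1 - a by lra.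
have q2 : (1 - a) ^+ q <= 2^-1.
  have := bernoulli_ineq q a0 => bq.
  have : (1 - a) ^+ q * (1 + a) ^+ q <= 1.
    by rewrite -exprMn exprn_ile1 //; nra.
  have : 0 <= (1 - a) ^+ q by rewrite exprn_ge0.
  nra.
have m2 : (1 - a) ^+ m <= 2^-1 ^+ (j + r * l).
  apply: le_trans (_ : (1 - a) ^+ (q * (j + r * l)) <= _).
    by apply: ler_wiXn2l => //; lra.
  by rewrite exprM lerXn2r // ?nnegrE ?exprn_ge0 ?invr_ge0.
have Nr : N%:R ^+ r <= 2 ^+ (r * l) :> R.
  by rewrite mulnC exprM lerXn2r ?nnegrE ?exprn_ge0 // -natrX ler_nat.
apply: le_trans (_ : 2 ^+ (r * l) * 2^-1 ^+ (j + r * l) * 2 ^+ j <= _).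
  by rewrite ler_wpM2r ?exprn_ge0 // ler_pM ?exprn_ge0.
by rewrite mulrAC -exprD addnC -exprMn divff ?pnatr_eq0 // expr1n.
Qed.

(** This bounds the logarithm of [n] by [2 * sqrt n], hence by [xi ^+ 2 * n] once
    [4 <= xi ^+ 4 * n]. *)
Lemma trunc_log2_sqr_le n : (0 < n)%N -> ((trunc_log 2 n).+1 ^ 2 <= 4 * n)%N.
Proof.
move=> n0; have := trunc_logP (isT : (1 < 2)%N) n0; set t := trunc_log 2 n => tn.
have : (t.+1 ^ 2 <= 4 * 2 ^ t)%N.
  elim: t {tn} => [//|[//|[//|t]] IHt]; rewrite (expnS 2) mulnCA.
  by apply: leq_trans (leq_mul (leqnn 2) IHt); rewrite -!mulnn; nia.
by move=> /leq_trans; apply; rewrite leq_mul2l.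
Qed.

Lemma absorbing_constants (R : realType) (n r : nat) (eps xi gamma : R) :
    (0 < n)%N -> (3 <= r)%N -> 0 < eps -> 0 < xi -> 0 < gamma ->
    n%:R^-1 <= eps ^+ 8 -> eps <= xi -> xi <= (gamma / 4) ^+ (r * r + 4) ->
    gamma <= r%:R^-1 ->
  exists m j : nat,
  [/\ [/\ r%:R * eps <= gamma / 16, 8 <= gamma * n%:R,
          forall f, (f <= m * (r * r))%N -> (f + r + r * r)%:R <= gamma / 16 * n%:R
        & (m * (r * r))%:R <= xi * n%:R],
      n%:R ^+ r * (1 - (gamma / 4) ^+ (r * r) / 2) ^+ m * 2 ^+ j <= 1
    & forall w : nat, w%:R <= xi ^+ 2 * n%:R -> (w <= j)%N].
Proof.
move=> n_gt0 r3 eps0 xi0 gamma0 Hn Hxi Hg gr; set L := (r * r)%N.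
set c := gamma / 4 in Hg *; set P := c ^+ L.
have r3' : (3 : R) <= r%:R by rewrite ler_nat.
have r0 : (0 : R) < r%:R by lra.
have rc : r%:R * c <= 4^-1.
  have : r%:R * gamma <= 1 by rewrite mulrC -ler_pdivlMr // div1r.
  by rewrite /c; lra.
have c0 : 0 < c by rewrite /c; lra.
have c12 : c <= 12^-1 by nra.
have P0 : 0 < P by rewrite exprn_gt0.
have P1 : P <= 1 by rewrite exprn_ile1 //; lra.
(* Of the four factors [c] beyond [P], three cancel [r ^+ 3] because [r * c <= 1/4]; the fourth
   remains and later compares [xi] with [gamma]. *)
have xiP : xi * r%:R ^+ 3 <= P * c / 64.
  have rc3 : (r%:R * c) ^+ 3 <= 4^-1 ^+ 3 by apply: lerXn2r => //; rewrite nnegrE; nra.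
  have Pc : 0 < P * c by rewrite mulr_gt0.
  apply: le_trans (_ : P * c ^+ 4 * r%:R ^+ 3 <= _).
    by rewrite ler_pM2r ?exprn_gt0 // -exprD.
  rewrite (_ : P * c ^+ 4 * r%:R ^+ 3 = P * c * (r%:R * c) ^+ 3); last by ring.
  by rewrite ler_pM2l //; lra.
have n0 : (0 : R) < n%:R by rewrite ltr0n.
have Pc : P * c <= c by nra.
have r2 : 9 <= r%:R ^+ 2 :> R by nra.
have xir3 : 3 * (xi * r%:R ^+ 2) <= xi * r%:R ^+ 3.
  by rewrite exprS; have := mulr_ge0 (ltW xi0) (sqr_ge0 (r%:R : R)); nra.
have xir2 : 3 * (xi * r%:R) <= xi * r%:R ^+ 2 by nra.
have xir1 : 3 * xi <= xi * r%:R by nra.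
have xi1 : xi <= 1000^-1 by lra.
have u8 : 1 <= xi ^+ 8 * n%:R.
  rewrite -ler_pdivrMr // div1r; apply: le_trans Hn _.
  by rewrite lerXn2r // nnegrE ltW.
have u_ge k : (k <= 8)%N -> 1 <= xi ^+ k * n%:R.
  move=> k8; apply: le_trans u8 _; rewrite ler_pM2r //.
  by apply: ler_wiXn2l => //; lra.
have [u2 u5] := (u_ge 2 isT, u_ge 5 isT); clear u_ge u8 Hn Hg.
have LR : L%:R = r%:R ^+ 2 :> R by rewrite natrM.
have L0 : (0 : R) < L%:R by rewrite LR; lra.
(* Here [xi * r ^+ 2 <= P * c / 192] and [c <= 1/12], and [192 * 12 = 2304]. *)
have u1L : 2304 * L%:R <= xi * n%:R.
  apply: le_trans (_ : 2304 * L%:R * (xi ^+ 2 * n%:R) <= _).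
    by rewrite ler_peMr //; lra.
  rewrite (_ : _ * _ = (2304 * (xi * L%:R)) * (xi * n%:R)); last by ring.
  by rewrite ler_piMl ?mulr_ge0 ?(ltW xi0) // LR; lra.
pose l := (trunc_log 2 n).+1.
have lu2 : l%:R <= xi ^+ 2 * n%:R.
  have u4 : 4 <= xi ^+ 4 * n%:R.
    have u40 : 0 <= xi ^+ 4 * n%:R by rewrite mulr_ge0 ?exprn_ge0 ?(ltW xi0).
    by move: u5; rewrite exprS -mulrA; nra.
  rewrite -ler_sqr ?nnegrE ?mulr_ge0 ?exprn_ge0 ?(ltW xi0) //.
  apply: le_trans (_ : 4 * n%:R <= _).
    by rewrite -natrX -natrM ler_nat; apply: trunc_log2_sqr_le.
  rewrite exprMn -exprM expr2 mulrA ler_pM2r //.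
(* Each absorber reduces the weight by the factor [1 - a]; [q] of them at least halve it. *)
clear u5; pose a := P / 2; pose q := (Num.trunc a^-1).+1.
have a0 : 0 < a by rewrite /a; lra.
have a1 : 0 <= a <= 1 by rewrite /a; lra.
have /andP[qa aq] : (Num.trunc a^-1)%:R <= a^-1 < q%:R.
  by apply: truncn_itv; rewrite invr_ge0 ltW.
have aV : 1 <= a^-1 by rewrite invf_ge1 // ; case/andP: a1.
have q2 : q%:R <= 2 * a^-1 by rewrite /q -addn1 natrD; lra.
(* As many absorbers of [L] vertices as fit into [xi * n], and the largest admissible size of
   [W]. *)
pose m := Num.trunc (xi * n%:R / L%:R); pose j := Num.trunc (xi ^+ 2 * n%:R).
have /andP[mu um] : m%:R <= xi * n%:R / L%:R < m.+1%:R.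
  by apply: truncn_itv; rewrite divr_ge0 ?mulr_ge0 // ltW.
have ju : j%:R <= xi ^+ 2 * n%:R by rewrite truncn_le; lra.
have mL : (m * L)%:R <= xi * n%:R by rewrite natrM -ler_pdivlMr.
exists m, j; split; first split=> //.
- have : r%:R * eps <= xi * r%:R by rewrite mulrC ler_pM2r.
  by rewrite /c in rc c12 xiP Pc *; lra.
- have : 9 * 1 <= xi * n%:R by rewrite LR in u1L; lra.
  have : xi * n%:R <= gamma * n%:R by rewrite ler_pM2r //; rewrite /c in Pc xiP; lra.
  lra.
- move=> f fmL; rewrite -addnA natrD.
  have rL : (r + r * r)%:R <= 2 * L%:R :> R by rewrite natrD -/L LR; nra.
  have fx : f%:R <= xi * n%:R by apply: le_trans mL; rewrite ler_nat.
  have : 2 * (xi * n%:R) <= gamma / 16 * n%:R.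
    by rewrite mulrA ler_pM2r //; rewrite /c in Pc xiP; lra.
  lra.
- apply: (exp_decay a1 (q := q) (l := l)).
  + by rewrite -ler_pdivrMr // div1r ltW.
  + by apply: ltnW; apply: trunc_log_ltn.
  rewrite -ltnS -(ltr_nat R); apply: le_lt_trans um.
  rewrite natrM natrD natrM.
  have jl : j%:R + r%:R * l%:R <= (1 + r%:R) * (xi ^+ 2 * n%:R) by nra.
  (* This is at most [xi * n / L] because [4 * (1 + r) * xi * r ^+ 2 <= P], which follows from
     [xiP]. *)
  apply: le_trans (_ : 2 * a^-1 * ((1 + r%:R) * (xi ^+ 2 * n%:R)) <= _).
    by rewrite ler_pM // addr_ge0 ?mulr_ge0.
  rewrite ler_pdivlMr //.
  rewrite [leLHS](_ : _ = a^-1 * ((2 * (1 + r%:R) * xi * L%:R) * (xi * n%:R))); last by ring.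
  rewrite ler_pdivrMl // ler_pM2r ?mulr_gt0 // LR /a.
  by move: xir3 xiP; rewrite !exprS; nra.
- by move=> w; rewrite truncn_ge_nat //; lra.
Qed.

(** * Choice of the hierarchy functions and conclusion *)

Theorem theorem5p2 (R : realType) :
  exists f1 f2 f3 f4 : R -> R,
    [/\ hierarchy_fun f1, hierarchy_fun f2, hierarchy_fun f3
      & hierarchy_fun f4] /\
    forall (n r : nat) (eps xi gamma : R),
      (0 < n)%N -> (3 <= r)%N -> 0 < eps -> 0 < xi -> 0 < gamma ->
      n%:R^-1 <= f1 eps -> eps <= f2 xi -> xi <= f3 gamma ->
      gamma <= f4 r%:R^-1 ->
    forall (V : finType) (e : rel V),
      irreflexive e -> #|V| = n ->
      (forall x : V,
         (1 - r%:R^-1 - eps) * n%:R <= (outdeg e x)%:R \/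
         (1 - r%:R^-1 - eps) * n%:R <= (indeg e x)%:R) ->
      (forall S : {set V},
         n%:R / r%:R <= #|S|%:R :> R -> ~ gamma_independent e gamma S) ->
    exists M : {set V},
      #|M|%:R <= xi * n%:R /\
      (forall W : {set V},
         W \subset ~: M -> (r %| #|W|)%N -> #|W|%:R <= xi ^+ 2 * n%:R ->
         absorbing (@transitive_tournament r) e M W).
Proof.
(* [f3] depends on gamma only; as [gamma <= r^-1], the exponent has
   [trunc gamma^-1] in place of [r]. *)
pose f3 (x : R) := (x / 4) ^+ (Num.trunc x^-1 ^ 2 + 4).
exists (fun x => x ^+ 8), id, f3, id; split.
  have hid : hierarchy_fun (R := R) id by split.
  split=> //; split.
  - by move=> x /andP[x0 x1]; rewrite exprn_gt0 // exprn_ile1 // ltW.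
  - by move=> x y x0 xy _; rewrite ltrXn2r // ltW.
  - move=> x /andP[x0 x1]; rewrite exprn_gt0 ?divr_gt0 //= exprn_ile1 //; lra.
  - move=> x y x0 xy y1; have y0 := lt_trans x0 xy.
    (* From [x] to [y] the exponent does not increase, which cannot decrease the power as the base
       is below one; the growth of the base gives strictness. *)
    apply: le_lt_trans (_ : (x / 4) ^+ (Num.trunc y^-1 ^ 2 + 4) < _); last first.
      by rewrite ltrXn2r ?addn4 //; lra.
    apply: ler_wiXn2l; [lra | lra |].
    by rewrite leq_add2r leq_sqr le_truncn // lef_pV2 ?posrE // ltW.
move=> n r eps xi gamma n0 r3 eps0 xi0 gamma0 Hn Hxi Hg gr V e irr cV.
move: cV n0 Hn => <- n0 Hn deg dense.
have {}Hg : xi <= (gamma / 4) ^+ (r * r + 4).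
  have r0 : (0 : R) < r%:R by rewrite ltr0n (leq_trans _ r3).
  have g1 : gamma <= 1 by apply: le_trans gr _; rewrite invf_le1 // ler1n (leq_trans _ r3).
  apply: le_trans Hg _; apply: ler_wiXn2l; [lra | lra |].
  rewrite leq_add2r -[(r * r)%N]/(r ^ 2)%N leq_sqr truncn_ge_nat; last first.
    by rewrite invr_ge0 ltW.
  by rewrite -[leLHS]invrK lef_pV2 ?posrE ?invr_gt0.
have [m [j [[eg ng fB mL] decay jW]]] :=
  absorbing_constants n0 r3 eps0 xi0 gamma0 Hn Hxi Hg gr.
pose N x := if (1 - r%:R^-1 - eps) * #|V|%:R <= (outdeg e x)%:R
  then [set y | e x y] else [set y | e y x].
have NE x : N x = [set y | e x y] \/ N x = [set y | e y x].
  by rewrite /N; case: ifP; [left | right].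
have cardN x : (1 - r%:R^-1 - eps) * #|V|%:R <= #|N x|%:R.
  rewrite /N; case: ifP => // /negP out; case: (deg x) => //.
have r0 : (0 : R) < r%:R by rewrite ltr0n (leq_trans _ r3).
have g1 : gamma <= 1 by apply: le_trans gr _; rewrite invf_le1 // ler1n (leq_trans _ r3).
have c01 : 0 < gamma / 4 <= 1 by lra.
have abs (Q : seq V) (F : {set V}) : size Q = r -> (#|F| <= m * (r * r))%N ->
    many (gamma / 4) (r * r) (fun A =>
      [/\ uniq A, {in A, forall x, x \notin F} & absorbs e r Q A]).
  move=> sQ cF; apply: (many_absorbers irr NE cardN _ r3 eps0) (fB _ cF) => //.
  by move=> S cS; rewrite ltNge; apply/negP/dense.
have [M [cM MW]] := absorbing_set n0 c01 abs (ltnW (ltnW r3)) (leqnn _) decay.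
exists M; split; first by apply: le_trans mL; rewrite ler_nat.
by move=> W WM rW cW; apply: MW => //; apply: jW.
Qed.
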